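(* Let $n\ge 2$ and let $\mu$ be a locally valid MV assignment of $M_{2,n}$ having exactly two flippable faces (i.e., a vertex of degree $2$ in ${\rm OFG}(M_{2,n})$). Let $-\mu$ be the opposite assignment, which negates every crease. Then the distance between $\mu$ and $-\mu$ in ${\rm OFG}(M_{2,n})$ (the length of a shortest path) is $\lceil n^2/2\rceil$.
   Context: The $2\times n$ Miura-ori $M_{2,n}$ ($n\ge1$) has faces $\alpha_{i,j}$ ($i\in\{1,2\}$, $j\in\{1,\dots,n\}$), interior vertices $x_1,\dots,x_{n-1}$, and creases $e_0$ and $e_{3k-1},e_{3k},e_{3k+1}$ ($k=1,\dots,n-1$). At $x_k$ the creases are left $e_{3k-3}$, top $e_{3k-1}$, right $e_{3k}$, bottom $e_{3k+1}$ (angles adjacent to the left crease obtuse). Face $\alpha_{1,j}$ is bordered by those of $e_{3j-4}$ (iff $j\ge2$), $e_{3j-3}$, $e_{3j-1}$ (iff $j\le n-1$); $\alpha_{2,j}$ by those of $e_{3j-2}$ (iff $j\ge2$), $e_{3j-3}$, $e_{3j+1}$ (iff $j\le n-1$). An MV assignment $\mu$ maps creases to $\{1,-1\}$; it is locally valid if for each $k$ exactly one of $\mu(e_{3k-1}),\mu(e_{3k}),\mu(e_{3k+1})$ differs from $\mu(e_{3k-3})$. The face flip $\mu_\alpha$ negates $\mu$ on the creases bordering $\alpha$; $\alpha$ is flippable under $\mu$ if $\mu,\mu_\alpha$ are both locally valid. ${\rm OFG}(M_{2,n})$ has the locally valid assignments as vertices, with $\mu\sim\mu_\alpha$ for each flippable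 $\alpha$. Two assignments are called opposite if they have the same flippable faces and opposite MV parity on every crease; for a locally valid $\mu$, $-\mu$ is locally valid and opposite to $\mu$. *)

(* Defs.v *)
From mathcomp Require Import all_boot.
Unset Printing Implicit Defensive.

(* Creases are indexed by natural numbers as in the paper:
   e_0 and e_{3k-1}, e_{3k}, e_{3k+1} for k = 1..n-1, i.e. {0} u {2,...,3n-2}. *)
Definition is_crease (n c : nat) : bool := (c == 0) || ((2 <= c) && (c <= 3 * n - 2)).

(* An MV assignment: a value per crease index; [true] encodes +1 (mountain),
   [false] encodes -1 (valley).  Only values on creases are meaningful. *)
Definition assignment := nat -> bool.

(* Two assignments are the same vertex iff they agree on every crease. *)
Definition agree (n : nat) (mu nu : assignment) : Prop :=
  forall c, is_crease n c -> mu c = nu c.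

Definition opp_asg (mu : assignment) : assignment := fun c => ~~ mu c.

(* Local validity: at each interior vertex x_k (1 <= k <= n-1) exactly one of
   mu(e_{3k-1}), mu(e_{3k}), mu(e_{3k+1}) differs from mu(e_{3k-3}). *)
Definition locally_valid (n : nat) (mu : assignment) : bool :=
  [forall k : 'I_n, (0 < (k : nat)) ==>
     (count (fun c => mu c != mu (3 * k - 3)) [:: 3 * k - 1; 3 * k; 3 * k + 1] == 1)].

(* Faces alpha_{i,j}: the face (i, j) : 'I_2 * 'I_n stands for alpha_{i+1, j+1}. *)
Definition face (n : nat) := ('I_2 * 'I_n)%type.

Definition borders (n : nat) (a : face n) (c : nat) : bool :=
  let jj := (a.2 : nat).+1 in
  if (a.1 : nat) == 0 then
    [|| (2 <= jj) && (c == 3 * jj - 4), c == 3 * jj - 3 | (jj <= n - 1) && (c == 3 * jj - 1)]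
  else
    [|| (2 <= jj) && (c == 3 * jj - 2), c == 3 * jj - 3 | (jj <= n - 1) && (c == 3 * jj + 1)].

Definition face_flip (n : nat) (mu : assignment) (a : face n) : assignment :=
  fun c => if borders n a c then ~~ mu c else mu c.

Definition flippable (n : nat) (mu : assignment) (a : face n) : bool :=
  locally_valid n mu && locally_valid n (face_flip n mu a).

Definition ofg_adj (n : nat) (mu nu : assignment) : Prop :=
  exists a : face n, flippable n mu a /\ agree n nu (face_flip n mu a).

Definition ofg_walk (n : nat) (mu nu : assignment) (k : nat) : Prop :=
  exists w : nat -> assignment,
    [/\ agree n (w 0) mu, agree n (w k) nu & forall i, i < k -> ofg_adj n (w i) (w i.+1)].

Definition ofg_dist_eq (n : nat) (mu nu : assignment) (d : nat) : Prop :=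
  ofg_walk n mu nu d /\ (forall k, ofg_walk n mu nu k -> d <= k).

(* Main.v *)
Require Import Defs.
From mathcomp Require Import all_boot all_order all_algebra zify.

Set Implicit Arguments.
Unset Strict Implicit.

Import Order.TTheory.

(* An assignment is the gradient of a height function on the faces: neighbouring
   faces differ by 1, and local validity is exactness around each vertex.  The
   height is unique up to a constant, and flipping a face moves a local extremum
   by 2.  Hence walks from mu to -mu correspond to deformations of h into c - h
   with c even, of least length min_m sum_a |h(a) - m|: as long as two heights
   differ, one of them can be moved towards the other.  A degree 2 vertex has one local extremum in each end column and none elsewhere, which forces both
   rows of h to be arithmetic progressions j and j + 1 up to sign, translation
   and swapping of the rows.  Pairing the heights j and n - j then gives
   min_m sum = sum_{j<n} |n - 2j| = ceil(n^2/2). *)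

Definition sg (b : bool) : int := if b then 1%R else (-1)%R.

Lemma sg_inj : injective sg.
Proof. by case; case. Qed.

Lemma sgN b : sg (~~ b) = (- sg b)%R.
Proof. by case: b. Qed.

Lemma sg_cases b : sg b = 1%R \/ sg b = (-1)%R.
Proof. by case: b; [left | right]. Qed.

(** Three signs add up to a given sign exactly when one of them is opposite to it. *)
Lemma locally_validP n mu :
  reflect (forall j, j.+1 < n ->
             (sg (mu (3 * j + 2)%N) + sg (mu (3 * j.+1)%N) + sg (mu (3 * j + 4)%N)
              = sg (mu (3 * j)%N))%R)
          (locally_valid n mu).
Proof.
have bal (k : nat) : 0 < k ->
    (count (fun c => mu c != mu (3 * k - 3)) [:: 3 * k - 1; 3 * k; 3 * k + 1] == 1)
    <-> (sg (mu (3 * k.-1 + 2)%N) + sg (mu (3 * k.-1.+1)%N) + sg (mu (3 * k.-1 + 4)%N)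
              = sg (mu (3 * k.-1)%N))%R.
  case: k => // k _ /=.
  have -> : 3 * k.+1 - 3 = 3 * k by lia.
  have -> : 3 * k.+1 - 1 = 3 * k + 2 by lia.
  have -> : 3 * k.+1 + 1 = 3 * k + 4 by lia.
  by case: (mu (3 * k)); case: (mu (3 * k + 2)); case: (mu (3 * k.+1));
     case: (mu (3 * k + 4)).
apply: (iffP forallP) => [H j jn | H k].
  by have := H (Ordinal jn); rewrite /= => /(bal j.+1 isT).
apply/implyP => k0; apply/bal => //; apply: H.
by rewrite prednK.
Qed.

(** * Height functions *)

(* The row [true] is the top row: [h true j] and [h false j] are the heights of
   the faces alpha_{1,j+1} and alpha_{2,j+1}.  The signs are those for which the
   height is read off counterclockwise around every vertex, the left crease
   being the one that is crossed downwards. *)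
Definition height_of (n : nat) (mu : assignment) (h : bool -> nat -> int) : Prop :=
  (forall j, j < n -> (h true j - h false j = sg (mu (3 * j)%N))%R) /\
  (forall j, j.+1 < n ->
     (h true j - h true j.+1 = sg (mu (3 * j + 2)%N))%R /\
     (h false j.+1 - h false j = sg (mu (3 * j + 4)%N))%R).

Lemma height_of_valid n mu h : height_of n mu h -> locally_valid n mu.
Proof.
move=> [Hv Hh]; apply/locally_validP => j jn.
have [] := Hh j jn; have := Hv j (ltnW jn); have := Hv j.+1 jn; lia.
Qed.

Lemma eq_height_of n mu h g : (forall b j, j < n -> h b j = g b j) ->
  height_of n mu h -> height_of n mu g.
Proof.
move=> E [Hv Hh]; split=> j jn; first by rewrite -!E ?Hv.
by have jn' := ltnW jn; rewrite -!E //; apply: Hh.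
Qed.

Lemma height_of_exists n mu :
  locally_valid n mu -> exists h, height_of n mu h.
Proof.
move/locally_validP => V.
pose top := fix top j : int :=
  if j is i.+1 then (top i - sg (mu (3 * i + 2)%N))%R else 0%R.
exists (fun b j => if b then top j else (top j - sg (mu (3 * j)%N))%R).
split=> [j _|j jn] /=; first by lia.
have := V j jn; lia.
Qed.

Lemma height_of_opp n mu h c :
  height_of n mu h -> height_of n (opp_asg mu) (fun b j => (c - h b j)%R).
Proof.
move=> [Hv Hh]; split=> [j jn|j jn]; rewrite /opp_asg !sgN.
  by have := Hv j jn; lia.
by have := Hh j jn; lia.
Qed.

Lemma agree_height_of n mu nu h :
  agree n mu nu -> height_of n mu h -> height_of n nu h.
Proof.
move=> A [Hv Hh]; split=> [j jn|j jn].
  by rewrite -A; [apply: Hv | rewrite /is_crease; lia].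
by rewrite -!A; [apply: Hh | rewrite /is_crease; lia..].
Qed.

(** Each crease separates two faces, so its sign is a height difference. For [n = 0] crease 0 would
    remain without any face. *)
Lemma height_of_agree n mu nu h g : 0 < n ->
  (forall b j, j < n -> h b j = g b j) ->
  height_of n mu h -> height_of n nu g -> agree n mu nu.
Proof.
move=> n0 E [Hv Hh] [Gv Gh] c cP; apply: sg_inj.
have [j [jn | jn]] : exists j,
    c = 3 * j /\ j < n \/ j.+1 < n /\ (c = 3 * j + 2 \/ c = 3 * j + 4).
  move: cP; rewrite /is_crease => cP.
  have [r0|[r1|r2]] : c %% 3 = 0 \/ c %% 3 = 1 \/ c %% 3 = 2 by lia.
  - by exists (c %/ 3); left; lia.
  - by exists (c %/ 3).-1; right; lia.
  - by exists (c %/ 3); right; lia.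
- by case: jn => -> jn; rewrite -Hv // -Gv // !E.
case: jn => jn; have jn' := ltnW jn.
have [H1 H2] := Hh j jn; have [G1 G2] := Gh j jn.
by case=> ->; rewrite -?H1 -?G1 -?H2 -?G2 !E.
Qed.

Lemma height_of_unique n mu h g :
  height_of n mu h -> height_of n mu g ->
  forall b j, j < n -> (g b j - h b j = g true 0%N - h true 0%N)%R.
Proof.
move=> [Hv Hh] [Gv Gh] b j jn.
have T : (g true j - h true j = g true 0%N - h true 0%N)%R.
  elim: j jn => // j IH jn; have := IH (ltnW jn).
  have := Hh j jn; have := Gh j jn; lia.
case: b => //; have := Hv j jn; have := Gv j jn; lia.
Qed.

Lemma height_adj_vert n mu h b j : height_of n mu h -> j < n ->
  (h b j - h (~~ b) j = 1)%R \/ (h b j - h (~~ b) j = -1)%R.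
Proof.
move=> [Hv _] jn.
by have := Hv j jn; have := sg_cases (mu (3 * j)); case: b => /=; lia.
Qed.

Lemma height_adj_horiz n mu h b j : height_of n mu h -> j.+1 < n ->
  (h b j.+1 - h b j = 1)%R \/ (h b j.+1 - h b j = -1)%R.
Proof.
move=> [_ Hh] jn; have := Hh j jn; have := sg_cases (mu (3 * j + 2)).
have := sg_cases (mu (3 * j + 4)); case: b => /=; lia.
Qed.

(** A local maximum for [s = 1], a local minimum for [s = -1]; neighbours missing at the ends impose
    nothing. *)
Definition extremal (n : nat) (h : bool -> nat -> int) (b : bool) (j : nat) (s : int) :=
  [/\ (h b j - h (~~ b) j = s)%R,
      (j.+1 < n -> (h b j - h b j.+1 = s)%R) &
      (0 < j -> (h b j - h b j.-1 = s)%R)].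

Definition upd (h : bool -> nat -> int) b j x : bool -> nat -> int :=
  fun b' j' => if (b' == b) && (j' == j) then x else h b' j'.

Definition top n (a : face n) : bool := (a.1 : nat) == 0.

Lemma borders_vert n (a : face n) k :
  borders n a (3 * k) = (k == a.2).
Proof. by rewrite /borders; case: ifP => _; lia. Qed.

Lemma borders_top n (a : face n) k : k.+1 < n ->
  borders n a (3 * k + 2) = top a && ((k == a.2) || (k.+1 == a.2)).
Proof. by move=> kn; rewrite /borders /top; case: ifP => _; lia. Qed.

Lemma borders_bot n (a : face n) k : k.+1 < n ->
  borders n a (3 * k + 4) = ~~ top a && ((k == a.2) || (k.+1 == a.2)).
Proof. by move=> kn; rewrite /borders /top; case: ifP => _; lia. Qed.

Lemma sg_face_flip n mu (a : face n) c :
  sg (face_flip n mu a c) = (if borders n a c then - sg (mu c) else sg (mu c))%R.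
Proof. by rewrite /face_flip; case: ifP; rewrite ?sgN. Qed.

(** All neighbours of the face have the same height; reflecting its height in that one negates
    exactly the differences across its border. *)
Lemma height_of_flip n mu h (a : face n) s :
  height_of n mu h -> extremal n h (top a) a.2 s ->
  height_of n (face_flip n mu a) (upd h (top a) a.2 (h (top a) a.2 - 2 * s)%R).
Proof.
case: a => i [j jn] [Hv Hh] [/= E0 E1 E2]; rewrite /upd; split=> k kn.
  have := Hv k kn; rewrite sg_face_flip borders_vert /=.
  by case: (eqVneq k j) => [->|_]; move: E0 E1 E2; case: (top _) => /=; lia.
have [] := Hh k kn; rewrite !sg_face_flip borders_top // borders_bot //=.
move: kn E0 E1 E2; move: (top _) => b {jn}; case: (eqVneq k j) => [->|kj].
  by case: b => /=; rewrite ?gtn_eqF //=; lia.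
case: (eqVneq k.+1 j) => [<-|_]; last by case: b => /=; lia.
by case: b => /=; lia.
Qed.

Lemma extremal_flippable n mu h (a : face n) s :
  height_of n mu h -> extremal n h (top a) a.2 s -> flippable n mu a.
Proof.
move=> H E; apply/andP; split; first exact: height_of_valid H.
exact: height_of_valid (height_of_flip H E).
Qed.

(* At each corner of a face, the two creases bordering it must carry opposite
   height differences for the flip to preserve the balance. *)
Lemma flippable_extremal n mu h (a : face n) :
  height_of n mu h -> flippable n mu a ->
  extremal n h (top a) a.2 (h (top a) a.2 - h (~~ top a) a.2)%R.
Proof.
case: a => i [j jn] [Hv Hh] /andP[_ /locally_validP F].
split=> //= [j1|].
  have := F j j1; have := Hh j j1; have := Hv j jn; have := Hv j.+1 j1.
  rewrite !sg_face_flip !borders_vert borders_top // borders_bot //=.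
  by rewrite !eqxx; case: (top _); case: eqP => //=; lia.
case: j jn F => // j jn F _ /=.
have := F j jn; have := Hh j jn; have := Hv j.+1 jn; have := Hv j (ltnW jn).
rewrite !sg_face_flip !borders_vert borders_top // borders_bot //=.
by rewrite !eqxx; case: (top _); case: eqP => //=; lia.
Qed.

(** * The graph distance between height functions *)

Definition total (n : nat) (s : bool -> nat -> int) : nat :=
  \sum_(j < n) (absz (s true j) + absz (s false j)).

Lemma total_upd n s b j x : j < n ->
  total n (upd s b j x) + absz (s b j) = total n s + absz x.
Proof.
move=> jn; rewrite /total (bigD1 (Ordinal jn)) //= [in RHS](bigD1 (Ordinal jn)) //=.
set A := \sum_(i < n | _) _; set B := \sum_(i < n | _) _.
have AB : A = B.
  by apply: eq_bigr => i /negbTE; rewrite -val_eqE /= /upd => ->; rewrite !andbF.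
by rewrite AB {A AB} /upd eqxx; case: b => /=; lia.
Qed.

(** Lower bound on walks: [s] records displacements in units of 2, and each flip changes a single
    entry of it by 1. *)
Lemma total_le_walk n w k h :
  height_of n (w 0) h -> (forall i, i < k -> ofg_adj n (w i) (w i.+1)) ->
  exists2 s, height_of n (w k) (fun b j => (h b j + 2 * s b j)%R) & total n s <= k.
Proof.
move=> H0; elim: k => [_|k IH W].
  exists (fun _ _ => 0%R); last by rewrite /total big1.
  by apply: eq_height_of H0 => b j _; lia.
have [|s Hs Ts] := IH; first by move=> i ik; apply: W; apply: ltnW.
have [a [Fa Aa]] := W k (ltnSn k).
have E := flippable_extremal Hs Fa.
have Hf := height_of_flip Hs E; set d := (X in (_ - 2 * X)%R) in Hf.
have d1 : absz d = 1.
  have := height_adj_vert (top a) Hs (ltn_ord a.2); rewrite -/d; lia.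
exists (upd s (top a) a.2 (s (top a) a.2 - d)%R); last first.
  by have := total_upd s (top a) (s (top a) a.2 - d)%R (ltn_ord a.2); lia.
apply: (@agree_height_of n (face_flip n (w k) a)).
  by move=> c cP; rewrite Aa.
apply: eq_height_of Hf => b j _; rewrite /upd; case: ifP => // /andP[/eqP-> /eqP->].
lia.
Qed.

Lemma top_surj n b j : j < n -> exists a : face n, top a = b /\ a.2 = j :> nat.
Proof.
by move=> jn; exists (if b then ord0 else ord_max, Ordinal jn); case: b.
Qed.

Lemma walk_cons n mu a nu k : flippable n mu a ->
  ofg_walk n (face_flip n mu a) nu k -> ofg_walk n mu nu k.+1.
Proof.
move=> Fa [w [w0 wk W]].
exists (fun i => if i is i'.+1 then w i' else mu); split=> //.
by case=> [_|i]; [exists a | apply: W].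
Qed.

(* Among the faces whose height must move in the direction [t], one whose
   height lies furthest behind in that direction is a local extremum. *)
Lemma exists_good_flip n mu nu h s :
  height_of n mu h -> height_of n nu (fun b j => (h b j + 2 * s b j)%R) ->
  0 < total n s ->
  exists a : face n, exists t : int,
    [/\ absz t = 1, (0 < t * s (top a) a.2)%R & extremal n h (top a) a.2 (- t)%R].
Proof.
move=> H G T0.
have [b0 [j0 nz]] : exists b0, exists j0 : 'I_n, s b0 j0 != 0%R.
  move: T0; rewrite lt0n sum_nat_eq0 negb_forall => /existsP[j].
  rewrite implyTb addn_eq0 !absz_eq0 negb_and => /orP[] ?.
    by exists true, j.
  by exists false, j.
pose t : int := (if (0 < s b0 j0)%R then 1 else -1)%R.
have t1 : t = 1%R \/ t = (-1)%R by rewrite /t; case: ifP; [left|right].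
pose P (x : bool * 'I_n) := (0 < t * s x.1 x.2)%R.
have P0 : P (b0, j0) by rewrite /P /t /=; case: ifP; lia.
case: (arg_minP (fun x : bool * 'I_n => (t * h x.1 x.2)%R) P0) => -[b j].
rewrite /P /= => Pbj min.
have [a [ab aj]] := top_surj b (ltn_ord j).
exists a, t; rewrite ab aj; split=> //; first by case: t1 => ->.
(* A neighbour further behind would, by minimality, not have to move in direction [t]; its target
   height would then differ from that of the chosen face by at least 3. *)
split=> [|j1|jpos].
- have := min (~~ b, j); rewrite /P /=.
  have := height_adj_vert b H (ltn_ord j); have := height_adj_vert b G (ltn_ord j).
  by move: Pbj; case: t1 => ->; lia.
- have := min (b, Ordinal j1); rewrite /P /=.
  have := height_adj_horiz b H j1; have := height_adj_horiz b G j1.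
  by move: Pbj; case: t1 => ->; lia.
case: j jpos Pbj min {aj} => -[//|j] /= j1 _ Pbj min.
have := min (b, Ordinal (ltnW j1)); rewrite /P /=.
have := height_adj_horiz b H j1; have := height_adj_horiz b G j1.
by move: Pbj; case: t1 => ->; lia.
Qed.

(** Greedy walk: each good flip moves one height towards its target and lowers the total by exactly
    1. *)
Lemma walk_of_total n mu nu h s : 0 < n ->
  height_of n mu h -> height_of n nu (fun b j => (h b j + 2 * s b j)%R) ->
  ofg_walk n mu nu (total n s).
Proof.
move=> n0; move: {2}(total n s) (erefl (total n s)) => k Tk; rewrite Tk.
elim: k mu h s Tk => [|k IH] mu h s Tk H G.
  exists (fun=> mu); split=> //; apply: (height_of_agree n0 _ H G) => b j jn.
  have : s b j = 0%R.
    move/eqP: Tk; rewrite sum_nat_eq0 => /forallP /(_ (Ordinal jn)) /=.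
    by case: b; lia.
  lia.
have [|a [t [t1 Pa E]]] := exists_good_flip H G; first by rewrite Tk.
apply: (walk_cons (extremal_flippable H E)).
have Tu := total_upd s (top a) (s (top a) a.2 - t)%R (ltn_ord a.2).
apply: (IH _ _ (upd s (top a) a.2 (s (top a) a.2 - t)%R) _ (height_of_flip H E)).
  have : t = 1%R \/ t = (-1)%R by lia.
  by move=> tt; move: Pa; case: tt Tu => ->; lia.
apply: eq_height_of G => b j _; rewrite /upd; case: ifP => // /andP[/eqP-> /eqP->].
lia.
Qed.

(** * Vertices of degree two *)

Lemma deg2_monotone n mu h : 2 <= n -> height_of n mu h ->
  #|[set a : face n | flippable n mu a]| = 2 ->
  exists2 t : int, absz t = 1 & forall b j, j < n -> (h b j = h b 0%N + t * j%:Z)%R.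
Proof.
move=> n2 H card2.
have adjv b j := @height_adj_vert n mu h b j H.
have adjh b j := @height_adj_horiz n mu h b j H.
have flip b j s : j < n -> extremal n h b j s ->
    exists a : face n, [/\ flippable n mu a, top a = b & a.2 = j :> nat].
  move=> jn E; have [a [ab aj]] := top_surj b jn.
  by exists a; split=> //; apply: (extremal_flippable (s := s) H); rewrite ab aj.
have three (a b c : face n) : flippable n mu a -> flippable n mu b ->
    flippable n mu c -> a != b -> a != c -> b != c -> False.
  move=> Fa Fb Fc ab ac bc.
  have : #|[set a; b; c]| <= 2.
    apply: leq_trans (_ : #|[set a : face n | flippable n mu a]| <= 2); last by rewrite card2.
    apply: subset_leq_card; apply/subsetP => x.
    by rewrite !inE => /orP[/orP[]|] /eqP->.
  by rewrite -setUA cardsU1 cards2 !inE negb_or ab ac bc.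
have [n' nE] : exists n', n = n'.+2 by exists n.-2; lia.
(* An end column always has an extremum: otherwise the two heights in the column next to it would
   differ by 3. *)
have [al [Fal al2]] : exists a : face n, flippable n mu a /\ a.2 = n.-1 :> nat.
  have A1 := adjv true n' ltac:(lia); have A2 := adjv true n'.+1 ltac:(lia).
  have A3 := adjh true n' ltac:(lia); have A4 := adjh false n' ltac:(lia); rewrite /= in A1 A2.
  have [b [s E]] : exists b s, extremal n h b n'.+1 s.
    have [E|E] : (h true n'.+1 - h true n' = h true n'.+1 - h false n'.+1)%R \/
           (h false n'.+1 - h false n' = h false n'.+1 - h true n'.+1)%R by lia.
      by exists true, (h true n'.+1 - h false n'.+1)%R; split=> //=; lia.
    by exists false, (h false n'.+1 - h true n'.+1)%R; split=> //=; lia.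
  by have [|a [Fa _ a2]] := flip _ _ _ _ E; [lia | exists a; split=> //; lia].
have [a0 [Fa0 a02]] : exists a : face n, flippable n mu a /\ a.2 = 0 :> nat.
  have A1 := adjv true 0 (ltnW n2); have A2 := adjv true 1 n2.
  have A3 := adjh true 0 n2; have A4 := adjh false 0 n2; rewrite /= in A1 A2.
  have [b [s E]] : exists b s, extremal n h b 0%N s.
    have [E|E] : (h true 0%N - h true 1%N = h true 0%N - h false 0%N)%R \/
           (h false 0%N - h false 1%N = h false 0%N - h true 0%N)%R by lia.
      by exists true, (h true 0%N - h false 0%N)%R; split=> //=; lia.
    by exists false, (h false 0%N - h true 0%N)%R; split=> //=; lia.
  by have [|a [Fa _ a2]] := flip _ _ _ _ E; [lia | exists a; split=> //; lia].
have neq (a b : face n) : (a.2 : nat) <> b.2 -> a != b.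
  by move=> ab; apply/eqP => E; apply: ab; rewrite E.
have inner b j s : 0 < j -> j.+1 < n -> ~ extremal n h b j s.
  move=> j0 j1 E; have [|a [Fa _ a2]] := flip _ _ _ _ E; first by lia.
  by apply: (three a a0 al) => //; apply: neq; lia.
(* If the rows started in opposite directions, both faces of column 0 would be extremal, which with
   [al] makes three flippable faces. *)
have first_step : (h true 1%N - h true 0%N = h false 1%N - h false 0%N)%R.
  have A1 := adjv true 0 (ltnW n2); have A2 := adjv true 1 n2.
  have A3 := adjh true 0 n2; have A4 := adjh false 0 n2; rewrite /= in A1 A2.
  apply/eqP; apply: contraT => /eqP ne.
  have ET : extremal n h true 0%N (h true 0%N - h false 0%N)%R by split=> //= _; lia.
  have EF : extremal n h false 0%N (h false 0%N - h true 0%N)%R by split=> //= _; lia.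
  have [|a [Fa at_ a2]] := flip _ _ _ _ ET; first by lia.
  have [|b [Fb bt b2]] := flip _ _ _ _ EF; first by lia.
  case: (three a b al) => //; try (by apply: neq; lia).
  by apply/eqP => E; move: at_; rewrite E bt.
have steps j : j.+1 < n -> (h true j.+1 - h true j = h true 1%N - h true 0%N)%R /\
    (h false j.+1 - h false j = h true 1%N - h true 0%N)%R.
  elim: j => [|j IH] jn; first by lia.
  have [IHt IHf] := IH (ltnW jn).
  (* If both rows turned at column [j.+1], one of them would have an extremum there; if only one
     turned, without an extremum, the heights in column [j.+2] would differ by 3. *)
  have N b : ~ ((h b j.+1 - h b j.+2 = h b j.+1 - h (~~ b) j.+1)%R /\
                (h b j.+1 - h b j = h b j.+1 - h (~~ b) j.+1)%R).
    by case=> E1 E2; apply: (inner b j.+1 (h b j.+1 - h (~~ b) j.+1)%R).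
  have := N true; have := N false; have := adjh true 0 n2.
  have := adjv true j.+2 jn; have := adjv true j.+1 (ltnW jn).
  have := adjh true j.+1 jn; have := adjh false j.+1 jn => /=; lia.
exists (h true 1%N - h true 0%N)%R.
  by have := adjh true 0 n2; lia.
move=> b; elim=> [|j IH] jn; first by lia.
by have := IH (ltnW jn); have := steps j jn; case: b {IH}; lia.
Qed.

(** * The cost of reflecting a staircase *)

Lemma sum_dist_center n : \sum_(j < n) absz (n%:Z - 2 * (j : nat)%:Z)%R = uphalf (n ^ 2).
Proof.
have S2 m : \sum_(j < m.+2) absz (m.+2%:Z - 2 * (j : nat)%:Z)%R =
            2 * m + 2 + \sum_(j < m) absz (m%:Z - 2 * (j : nat)%:Z)%R.
  (* The outer terms are [m + 2] and [m]; shifting the index turns the others into the sum for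
     [m]. *)
  rewrite big_ord_recl big_ord_recr /=.
  rewrite (eq_bigr (fun j : 'I_m => absz (m%:Z - 2 * (j : nat)%:Z)%R)).
    rewrite /bump /=; lia.
  by move=> j _; rewrite /= /bump; congr absz; lia.
have [m] := ubnP n; elim: m n => // m IH [|[|n]] nm.
- by rewrite big_ord0.
- by rewrite big_ord1.
rewrite S2 IH; last by lia.
have -> : n.+2 ^ 2 = 2 * (2 * n + 2) + n ^ 2 by lia.
lia.
Qed.

(** Reversing the second row pairs height [j] with height [n - j], so that [m] cancels in the
    triangle inequality. *)
Lemma staircase_pairing n (m : int) :
  \sum_(j < n) (absz (m - (j : nat)%:Z)%R + absz (m - 1 - (j : nat)%:Z)%R) =
  \sum_(j < n) (absz (m - (j : nat)%:Z)%R + absz (n%:Z - (j : nat)%:Z - m)%R).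
Proof.
rewrite !big_split /=; congr (_ + _).
rewrite (reindex_inj rev_ord_inj) /=; apply: eq_bigr => j _.
by have := ltn_ord j; lia.
Qed.

Lemma staircase_ge n (m : int) :
  uphalf (n ^ 2) <=
  \sum_(j < n) (absz (m - (j : nat)%:Z)%R + absz (m - 1 - (j : nat)%:Z)%R).
Proof.
rewrite staircase_pairing -sum_dist_center; apply: leq_sum => j _; lia.
Qed.

(** This [m] lies between [j] and [n - j] for every [j < n], so each triangle inequality is an
    equality. *)
Lemma staircase_half n (m := (n./2)%:Z%R) :
  \sum_(j < n) (absz (m - (j : nat)%:Z)%R + absz (m - 1 - (j : nat)%:Z)%R) =
  uphalf (n ^ 2).
Proof.
rewrite staircase_pairing -sum_dist_center; apply: eq_bigr => j _.
by have := ltn_ord j; rewrite /m; lia.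
Qed.

(** Here [l] is the starting height of the row that lags behind in direction [t]; the rows are
    [l + t * j] and [l + t * (j + 1)]. *)
Lemma total_staircase n h (t : int) : absz t = 1 -> absz (h true 0%N - h false 0%N)%R = 1 ->
  (forall b j, j < n -> (h b j = h b 0%N + t * j%:Z)%R) ->
  exists l : int, forall c,
    total n (fun b j => (c - h b j)%R) =
    \sum_(j < n) (absz (t * (c - l) - (j : nat)%:Z)%R
                  + absz (t * (c - l) - 1 - (j : nat)%:Z)%R).
Proof.
move=> t1 v1 mono.
have [t_eq|t_eq] : t = 1%R \/ t = (-1)%R by lia.
  exists (Num.min (h true 0%N) (h false 0%N)) => c; apply: eq_bigr => j _.
  by rewrite !(mono _ _ (ltn_ord j)) t_eq; lia.
exists (Num.max (h true 0%N) (h false 0%N)) => c; apply: eq_bigr => j _.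
by rewrite !(mono _ _ (ltn_ord j)) t_eq; lia.
Qed.

Theorem theorem5p5 (n : nat) (mu : assignment) :
  2 <= n ->
  locally_valid n mu ->
  #|[set a : face n | flippable n mu a]| = 2 ->
  ofg_dist_eq n mu (opp_asg mu) (uphalf (n ^ 2)).
Proof.
move=> n2 V card2; have n0 := ltnW n2.
have [h H] := height_of_exists V.
have [t t1 mono] := deg2_monotone n2 H card2.
have v1 : absz (h true 0%N - h false 0%N)%R = 1.
  by have /= := height_adj_vert true H n0; lia.
have [l cost] := total_staircase t1 v1 mono.
have tt : (t * t = 1)%R by have [->|->] : t = 1%R \/ t = (-1)%R by lia.
split=> [|k [w [w0 wk W]]].
  (* Reflecting [h] in the central height moves each face by twice its distance to that height,
     hence by that many flips. *)
  have E : total n (fun b j => (l + t * (n./2)%:Z - h b j)%R) = uphalf (n ^ 2).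
    rewrite cost -[RHS]staircase_half; apply: eq_bigr => j _.
    by have -> : (t * (l + t * (n./2)%:Z - l) = (n./2)%:Z)%R by lia.
  rewrite -E; apply: (walk_of_total n0 H).
  apply: eq_height_of (height_of_opp (2 * (l + t * (n./2)%:Z))%R H) => b j _; lia.
have H0 : height_of n (w 0) h by apply: agree_height_of H => c cP; rewrite w0.
have [s Hs Ts] := total_le_walk H0 W.
(* Both [h + 2 * s] and [- h] are heights of the opposite assignment, so [s + h] is constant: the
   centre of reflection. *)
have U := height_of_unique (height_of_opp 0%R H) (agree_height_of wk Hs).
apply: leq_trans (staircase_ge n (t * (s true 0%N + h true 0%N - l))%R) _.
rewrite -cost; apply: leq_trans Ts; rewrite /total leq_eqVlt; apply/orP; left; apply/eqP.
by apply: eq_bigr => j _; have := U true j (ltn_ord j); have := U false j (ltn_ord j); lia.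
Qed.
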